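(* Let $N\ge 2$ and $M>2$ be integers and consider the indirect control system described in the context, with real Lie algebra $\mathcal{L}$ generated by $iH_0$, $iH_x^j=i(1_S\otimes\sigma_x^j)$ and $iH_y^j=i(1_S\otimes\sigma_y^j)$, $j=1,\dots,M$. If Conditions 1, 2 and 3 are satisfied, then $\mathcal{L}=su(2^M N)$.
   Context: The controlled system is $\mathbb{C}^N$ with orthonormal basis $|1\rangle,\dots,|N\rangle$; $e_{jk}=|j\rangle\langle k|$. $H_S=\sum_{j=1}^N E_j e_{jj}$ with real $E_j$, $\sum_j E_j=0$. For $1\le j<k\le N$: $x_{jk}=e_{jk}+e_{kj}$, $y_{jk}=i(e_{jk}-e_{kj})$, $h_j=e_{jj}-e_{j+1,j+1}$; $x_j=x_{j,j+1}$, $y_j=y_{j,j+1}$; $s_j^{(1)}=x_j$, $s_j^{(2)}=y_j$. The accessor is $(\mathbb{C}^2)^{\otimes M}$ ($M$ qubits); $\sigma_\alpha^j$ is the Pauli matrix $\sigma_\alpha$ ($\alpha=x,y,z$) on the $j$-th qubit, $\sigma_0=1$, and $\sigma_{[\alpha]}=\prod_{j=1}^M\sigma^j_{\alpha_j}$ for $[\alpha]\in\{x,y,z,0\}^M$. $1_S,1_A$ denote identities. $H_A=\sum_{j=1}^M\hbar\omega_j\sigma_z^j+\sum_{j=1}^{M-1}c_j\sigma_x^j\sigma_x^{j+1}$; $H_S'=\sum_{j=1}^{N-1}d_j x_j\otimes 1_A$; $H_{SA}=\sum_{j=1}^{N-1}\sum_{k=1}^2\sum_{[\alpha]\in\{x,y\}^M}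 g^{j(k)}_{[\alpha]}\, s_j^{(k)}\otimes\sigma_{[\alpha]}$; all coefficients real; $H_0=H_S\otimes 1_A+H_S'+1_S\otimes H_A+H_{SA}$. (The control Hamiltonian is $H=H_0+\sum_j(f_j(t)H_x^j+f'_j(t)H_y^j)$, and complete controllability means $\mathcal{L}=su(2^MN)$.) Condition 1: $c_j\neq 0$ for $j=1,\dots,M-1$. Condition 2: there exist $2(N-1)$ elements $[\beta]_1,\dots,[\beta]_{2(N-1)}$ of $\{x,y\}^M$ such that the $2(N-1)\times 2(N-1)$ matrix $G$ whose $r$-th row is $(g^{1(1)}_{[\beta]_r},\dots,g^{(N-1)(1)}_{[\beta]_r},g^{1(2)}_{[\beta]_r},\dots,g^{(N-1)(2)}_{[\beta]_r})$ has nonzero determinant. Condition 3: the $N$-level system with drift $H_S$ and control Hamiltonian $\sum_{j=1}^{N-1}d_jx_j$ is completely controllable, i.e. the real Lie algebra generated by $iH_S$ and $i\sum_{j=1}^{N-1}d_jx_j$ equals $su(N)$. *)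

(* Defs.v *)
From HB Require Import structures.
From mathcomp Require Import all_boot all_order all_algebra.
From mathcomp Require Import reals.
From mathcomp.real_closed Require Import complex mxtens.
Set Implicit Arguments. Unset Strict Implicit. Unset Printing Implicit Defensive.
Import Order.TTheory GRing.Theory Num.Theory.
Local Open Scope ring_scope.

Section Defs.
Variable R : realType.
Local Notation C := R[i].

Definition rC (a : R) : C := Complex a 0.

Definition lie_closed n (P : 'M[C]_n -> Prop) : Prop :=
  [/\ P 0,
      (forall X Y, P X -> P Y -> P (X + Y)),
      (forall (a : R) X, P X -> P (rC a *: X)) &
      (forall X Y, P X -> P Y -> P (X *m Y - Y *m X))].

Definition lie_gen n (S : 'M[C]_n -> Prop) (X : 'M[C]_n) : Prop :=
  forall P : 'M[C]_n -> Prop, lie_closed P -> (forall Y, S Y -> P Y) -> P X.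

Definition adjmx n (X : 'M[C]_n) : 'M[C]_n := (map_mx (@conjc R) X)^T.

Definition su n (X : 'M[C]_n) : Prop := adjmx X = - X /\ \tr X = 0.

Definition generates_su n (S : 'M[C]_n -> Prop) : Prop :=
  forall X, lie_gen S X <-> su X.

(* ---- the N-level system, 0-based indices: basis |0>,...,|N-1> ---- *)
Definition emx N (j k : nat) : 'M[C]_N :=
  \matrix_(a, b) ((nat_of_ord a == j) && (nat_of_ord b == k))%:R.
Definition xS N (j : nat) : 'M[C]_N := emx N j j.+1 + emx N j.+1 j.
Definition yS N (j : nat) : 'M[C]_N := 'i *: (emx N j j.+1 - emx N j.+1 j).
Definition sS N (j : nat) (k : bool) : 'M[C]_N := if k then yS N j else xS N j.
Definition HS N (E : 'I_N -> R) : 'M[C]_N := \sum_(j < N) rC (E j) *: emx N j j.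

Inductive pauli := P0 | Px | Py | Pz.

Definition pauli_mx (p : pauli) : 'M[C]_2 :=
  \matrix_(a, b)
   match p with
   | P0 => (a == b)%:R
   | Px => (a != b)%:R
   | Py => if a == b then 0 else if nat_of_ord a == 0%N then - 'i else 'i
   | Pz => if a == b then (if nat_of_ord a == 0%N then 1 else -1) else 0
   end.

(* the j-th qubit of the basis index a of (C^2)^{(x)M} *)
Definition qbit (M : nat) (j : 'I_M) (a : 'I_(2 ^ M)) : 'I_2 :=
  inord (odd (a %/ 2 ^ j)).

(* sigma_[alpha] = prod_j sigma_{alpha_j}^j : tensor product over qubits *)
Definition pstring M (alpha : 'I_M -> pauli) : 'M[C]_(2 ^ M) :=
  \matrix_(a, b) \prod_(j < M) pauli_mx (alpha j) (qbit j a) (qbit j b).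

Definition sigma1 M (p : pauli) (j : 'I_M) : 'M[C]_(2 ^ M) :=
  pstring (fun k => if k == j then p else P0).

Definition sigmaxx M (j : nat) : 'M[C]_(2 ^ M) :=
  pstring (fun k : 'I_M => if (nat_of_ord k == j) || (nat_of_ord k == j.+1)
                           then Px else P0).

Definition pstring_xy M (alpha : {ffun 'I_M -> bool}) : 'M[C]_(2 ^ M) :=
  pstring (fun k => if alpha k then Py else Px).

Definition kron m n (A : 'M[C]_m) (B : 'M[C]_n) : 'M[C]_(m * n) := tensmx A B.

(* H_A = sum_j hw_j sigma_z^j + sum_{j < M-1} c_j sigma_x^j sigma_x^{j+1},
   with hw_j = hbar omega_j *)
Definition HA M (hw : 'I_M -> R) (c : nat -> R) : 'M[C]_(2 ^ M) :=
  \sum_(j < M) rC (hw j) *: sigma1 Pz j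
  + \sum_(j < M.-1) rC (c j) *: sigmaxx M j.

Definition H0 N M (E : 'I_N -> R) (d : nat -> R) (hw : 'I_M -> R) (c : nat -> R)
  (g : nat -> bool -> {ffun 'I_M -> bool} -> R) : 'M[C]_(N * 2 ^ M) :=
  kron (HS E) 1
  + \sum_(j < N.-1) rC (d j) *: kron (xS N j) 1
  + kron 1 (HA hw c)
  + \sum_(j < N.-1) \sum_(k : bool) \sum_(alpha : {ffun 'I_M -> bool})
        rC (g j k alpha) *: kron (sS N j k) (pstring_xy alpha).

Definition ctrl_gens N M (H : 'M[C]_(N * 2 ^ M)) (X : 'M[C]_(N * 2 ^ M)) : Prop :=
  X = 'i *: H \/
  exists j : 'I_M, X = 'i *: kron 1 (sigma1 Px j) \/ X = 'i *: kron 1 (sigma1 Py j).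

Definition Gmx N M (g : nat -> bool -> {ffun 'I_M -> bool} -> R)
  (beta : 'I_(2 * N.-1) -> {ffun 'I_M -> bool}) : 'M[R]_(2 * N.-1) :=
  \matrix_(r, col) (if (nat_of_ord col < N.-1)%N then g col false (beta r)
                    else g (col - N.-1)%N true (beta r)).

End Defs.

(* Main.v *)
Require Import Defs.
From HB Require Import structures.
From mathcomp Require Import all_boot all_order all_algebra.
From mathcomp Require Import reals.
From mathcomp.real_closed Require Import complex mxtens.
From mathcomp Require Import ring lra zify.
Set Implicit Arguments. Unset Strict Implicit. Unset Printing Implicit Defensive.
Import Order.TTheory GRing.Theory Num.Theory.
Local Open Scope ring_scope.

(** Index Pauli strings by [al : F_2^(2M)], so that products add indices and two
    strings commute or anticommute according to the symplectic form [Omega].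
    Conjugating by the local Paulis [sigma_x^j], [sigma_z^j] and averaging with
    signs isolates any single string component, and [L] is stable under this.
    As [M > 2], the couplings [sigma_x^j sigma_x^(j+1)], the local terms and the
    full strings of [H_SA] are different strings, so [i H_0] yields
    [i sigma_x^j sigma_x^(j+1)] and [i (sum_(j,k) g s_j^(k)) (x) sigma_[beta]]
    for every [beta].  The former, with the local Paulis, generate all
    [i 1 (x) sigma_al], [al <> 0], and these move any [X (x) sigma_al] to any
    other nonzero string; inverting [G] then gives [i s_j^(k) (x) sigma_al].
    The set of [X] with [X (x) sigma_al] in [L] for all [al <> 0] is closed under
    brackets (use two commuting strings) and under [i {X, Y}] (use two
    anticommuting ones), hence contains all skew-Hermitian [X]; brackets along
    the same string give [su(N) (x) 1]. *)

(** * Symplectic labels of Pauli strings *)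

(* [(a, b)] stands for [sigma_x^a sigma_z^b] up to phase, so that [ly = lx + lz]. *)
Definition plabel : Type := (bool * bool)%type.
HB.instance Definition _ := GRing.Zmodule.on plabel.
HB.instance Definition _ := Finite.on plabel.

Definition lx : plabel := (true, false).
Definition lz : plabel := (false, true).
Definition ly : plabel := (true, true).

(** The symplectic form on [F_2^2]: it is true exactly when the two one-qubit Paulis anticommute. *)
Definition omega (p q : plabel) : bool := (p.1 && q.2) (+) (p.2 && q.1).

Section Labels.
Variable M : nat.
Local Notation lab := {ffun 'I_M -> plabel}.
Implicit Types (al be ga : lab) (j k : 'I_M) (p q : plabel).

Definition Omega al be : bool := \big[addb/false]_j omega (al j) (be j).

Definition single j p : lab := [ffun k => if k == j then p else 0].

Lemma Omega_sym al be : Omega al be = Omega be al.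
Proof.
by apply: eq_bigr => j _; rewrite /omega addbC; congr (_ (+) _); rewrite andbC.
Qed.

Lemma OmegaDr al be ga : Omega al (be + ga) = Omega al be (+) Omega al ga.
Proof.
rewrite /Omega -big_split; apply: eq_bigr => j _ /=; rewrite ffunE.
by move: (al j) (be j) (ga j) => [[] []] [[] []] [[] []].
Qed.

Lemma Omega_self al : Omega al al = false.
Proof. by rewrite /Omega big1 // => j _; rewrite /omega andbC addbb. Qed.

Lemma Omega0r al : Omega al 0 = false.
Proof.
by rewrite /Omega big1 // => j _; rewrite /omega ffunE !andbF.
Qed.

Lemma Omega_single al j p : Omega al (single j p) = omega (al j) p.
Proof.
rewrite /Omega (bigD1 j) //= big1 ?addbF ?ffunE ?eqxx // => k kj.
by rewrite ffunE (negbTE kj) /omega !andbF.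
Qed.

Lemma label_neq0 al : al != 0 -> exists j, al j != 0.
Proof.
move=> al0; apply/existsP; apply: contraNT al0 => /existsPn al0.
by apply/eqP/ffunP => j; rewrite ffunE; apply/eqP; rewrite -[_ == _]negbK al0.
Qed.

Lemma omega_nondeg p : p != 0 -> exists2 q, q != 0 & omega p q.
Proof. by move: p => [[] []] //= _; [exists lx|exists lz|exists lx]. Qed.

Lemma Omega_nondeg al : al != 0 -> exists be, Omega al be.
Proof.
move=> /label_neq0 [j /omega_nondeg [q _ oq]].
by exists (single j q); rewrite Omega_single.
Qed.

(** Pairing with [lx] reads off the second bit of an entry and pairing with [lz] the first, so these
    [2M] pairings are coordinates on labels. *)
Lemma label_eq al be :
  (forall j, Omega (single j lx) al = Omega (single j lx) be) ->
  (forall j, Omega (single j lz) al = Omega (single j lz) be) -> al = be.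
Proof.
move=> hx hz; apply/ffunP => j; move: (hx j) (hz j).
rewrite ![Omega (single _ _) _]Omega_sym !Omega_single.
by move: (al j) (be j) => [[] []] [[] []].
Qed.

Lemma addpp p : p + p = 0. Proof. by move: p => [[] []]. Qed.

Lemma addll al : al + al = 0.
Proof. by apply/ffunP => j; rewrite !ffunE addpp. Qed.

Lemma addKl al be : al + (al + be) = be.
Proof. by rewrite addrA addll add0r. Qed.

Lemma single0 j : single j 0 = 0.
Proof. by apply/ffunP => k; rewrite !ffunE if_same. Qed.

Lemma singleD j p q : single j (p + q) = single j p + single j q.
Proof. by apply/ffunP => k; rewrite !ffunE; case: eqP; rewrite ?addr0. Qed.

Lemma single_neq0 j p : p != 0 -> single j p != 0.
Proof. by apply: contraNneq => /ffunP /(_ j); rewrite !ffunE eqxx => ->. Qed.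

(** Two distinct nonzero vectors of the plane [F_2^2] form a symplectic basis; [p + q != 0] says
    that they are distinct. *)
Lemma omega_neq p q : p != 0 -> q != 0 -> p + q != 0 -> omega p q.
Proof. by move: p q => [[] []] [[] []]. Qed.

(** * Generating all nonzero labels by symplectic transvections *)

Section Transvections.
(** In the application [G al] says that [i 1 (x) sigma_al] lies in the Lie algebra, and [GD] is the
    bracket of two anticommuting strings. *)
Variable G : lab -> Prop.
Hypothesis GD : forall al be, G al -> G be -> Omega al be -> G (al + be).
Hypothesis Gx : forall j, G (single j lx).
Hypothesis Gy : forall j, G (single j ly).
Hypothesis Gxx : forall j k, k = j.+1 :> nat -> G (single j lx + single k lx).

Lemma transvection_single j p : p != 0 -> G (single j p).
Proof.
move: p => [[] []] // _; try exact: Gx; try exact: Gy.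
have -> : (false, true) = lx + ly :> plabel by [].
rewrite singleD; apply: GD => //.
by rewrite Omega_single ffunE eqxx.
Qed.

(** The old and the new entry at [j] are both nonzero, so for [q != 0] the old entry anticommutes
    with [q] by [omega_neq], and [GD] applies. *)
Lemma transvection_modify al j q : G al -> al j != 0 -> al j + q != 0 -> G (al + single j q).
Proof.
move=> Gal aj ajq; have [->|q0] := eqVneq q 0; first by rewrite single0 addr0.
by apply: GD => //; [apply: transvection_single | rewrite Omega_single; apply: omega_neq].
Qed.

Lemma transvection_pair_lx j k p q : j != k -> p != 0 -> q != 0 ->
  G (single j lx + single k lx) -> G (single j p + single k q).
Proof.
move=> jk p0 q0 G1.
have kj : k != j by rewrite eq_sym.
have G2 : G (single j lx + single k q).
  have -> : single j lx + single k q = single j lx + single k lx + single k (lx + q).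
    by rewrite singleD -!addrA addKl.
  by apply: transvection_modify; rewrite // !ffunE eqxx (negbTE kj) // add0r addrA addpp add0r.
have -> : single j p + single k q = single j lx + single k q + single j (lx + p).
  by rewrite singleD addrAC addrA addll add0r.
by apply: transvection_modify; rewrite // !ffunE eqxx (negbTE jk) ?addr0 // addrA addpp add0r.
Qed.

(** Induction on the distance: a pair on [j] and the left neighbour [l] of [k] is extended to [k]
    through the pairs on [l] and [k]. *)
Lemma transvection_pair_lt n j k p q : k = (j + n.+1)%N :> nat -> p != 0 -> q != 0 ->
  G (single j p + single k q).
Proof.
elim: n j k p q => [|n IH] j k p q ek p0 q0.
  apply: transvection_pair_lx => //; last by apply: Gxx; rewrite ek addn1.
  by rewrite -val_eqE /= ek; lia.
have hl : (j + n.+1 < M)%N by have := ltn_ord k; lia.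
pose l := Ordinal hl.
have jl : (j == l) = false by rewrite -val_eqE /=; lia.
have jk : (j == k) = false by rewrite -val_eqE /= ek; lia.
have lk : (l == k) = false by rewrite -val_eqE /= ek; lia.
have lj : (l == j) = false by rewrite eq_sym.
have kj : (k == j) = false by rewrite eq_sym.
have kl : (k == l) = false by rewrite eq_sym.
apply: transvection_pair_lx => //; first by rewrite jk.
have G1 : G (single j lx + single l lz) by apply: IH.
have Glk r s : r != 0 -> s != 0 -> G (single l r + single k s).
  move=> r0 s0; apply: transvection_pair_lx => //; first by rewrite lk.
  by apply: Gxx; rewrite /= ek addnS.
(* Two steps carry the end of the string from [l] to [k]: at [l] the entries [lz], [lx], [ly] sum to
   0, and at [k] the sum [lz + ly] is [lx]. *)
have G2 : G (single j lx + single l lz + (single l lx + single k lz)).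
  apply: GD => //; first exact: Glk.
  by rewrite OmegaDr !Omega_single !ffunE eqxx !(lj, kj, kl).
have G3 : G (single j lx + single l lz + (single l lx + single k lz) +
             (single l ly + single k ly)).
  apply: GD => //; first exact: Glk.
  by rewrite OmegaDr !Omega_single !ffunE !eqxx !(lj, kj, kl, lk).
congr G : G3; apply/ffunP => i; rewrite !ffunE.
by case: (i == j); case: (i == l); case: (i == k).
Qed.

Lemma transvection_pair j k p q : j != k -> p != 0 -> q != 0 -> G (single j p + single k q).
Proof.
move=> jk p0 q0; have := jk; rewrite -val_eqE neq_ltn /= => /orP[jk1|kj1].
  by apply: (@transvection_pair_lt (k - j.+1)%N) => //; lia.
by rewrite addrC; apply: (@transvection_pair_lt (j - k.+1)%N) => //; lia.
Qed.

(** Induction on the number of qubits where the label is nontrivial. *)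
Lemma transvection_all al : al != 0 -> G al.
Proof.
have [n] := ubnP #|[pred j | al j != 0]|; elim: n al => // n IH al sz al0.
have [j aj] := label_neq0 al0.
have [/existsP [k /andP [kj ak]]|/existsPn ns] := boolP [exists k, (k != j) && (al k != 0)].
  have jk : j != k by rewrite eq_sym.
  pose be := al + single k (al k).
  have bj : be j = al j by rewrite !ffunE (negbTE jk) addr0.
  have bk : be k = 0 by rewrite !ffunE eqxx addpp.
  have Gbe : G be.
    apply: IH; last by apply: contraNneq aj => be0; rewrite -bj be0 ffunE.
    rewrite (cardD1 k) inE ak add1n ltnS in sz; apply: leq_ltn_trans sz.
    apply/subset_leq_card/subsetP => i; rewrite !inE !ffunE.
    by case: (eqVneq i k) => [->|_]; rewrite ?addpp ?eqxx // addr0.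
  (* [be] vanishes at [k], so the pair with [q] at [j] and [al k] at [k] anticommutes with it
     through site [j] alone. Adding this pair restores site [k] but turns [al j] into [al j + q]; a
     one-site change undoes the latter. *)
  have [q q0 oq] := omega_nondeg aj.
  have Gd : G (al + single j q).
    have -> : al + single j q = be + (single j q + single k (al k)).
      by rewrite /be [single j q + _]addrC -addrA addKl.
    apply: GD => //; first exact: transvection_pair.
    by rewrite OmegaDr !Omega_single bj oq bk.
  have -> : al = al + single j q + single j q by rewrite -addrA addll addr0.
  apply: transvection_modify => //; rewrite !ffunE eqxx -?addrA ?addpp ?addr0 //.
  by move: oq; case: (al j) q {aj q0 Gd} => [[] []] [[] []].
have -> : al = single j (al j); last exact: transvection_single.
apply/ffunP => i; rewrite !ffunE; case: (eqVneq i j) => [->//|ij].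
by apply/eqP; have := ns i; rewrite ij /= negbK.
Qed.
End Transvections.

(* If [al] and [be] commute, go through a third string anticommuting with both. *)
Lemma transport (H : lab -> Prop) al be :
  (forall al ga, H al -> ga != 0 -> Omega al ga -> H (al + ga)) ->
  al != 0 -> be != 0 -> H al -> H be.
Proof.
move=> HD.
have step al1 be1 : H al1 -> Omega al1 be1 -> H be1.
  move=> H1 o1; have <- : al1 + (al1 + be1) = be1 by rewrite addKl.
  apply: HD => //; last by rewrite OmegaDr Omega_self.
  by apply: contraTneq o1 => e; rewrite -[be1](addKl al1) e addr0 Omega_self.
move=> al0 be0 Hal.
suff [de oa ob] : exists2 de, Omega al de & Omega de be.
  exact: step (step _ _ Hal oa) ob.
have [g1 o1] := Omega_nondeg al0; have [g2 o2] := Omega_nondeg be0.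
have [o12|/negbTE o12] := boolP (Omega be g1); first by exists g1; rewrite // Omega_sym.
have [o21|/negbTE o21] := boolP (Omega al g2); first by exists g2; rewrite // Omega_sym.
exists (g1 + g2); first by rewrite OmegaDr o1 o21.
by rewrite Omega_sym OmegaDr o12 o2.
Qed.

End Labels.

(** * Skew-Hermitian matrices and Lie-closed sets *)

Section Scalars.
Variable R : realType.
Local Notation C := R[i].

Lemma rC0 : rC (0 : R) = 0. Proof. exact: (rmorph0 (real_complex R)). Qed.
Lemma rC1 : rC (1 : R) = 1. Proof. exact: (rmorph1 (real_complex R)). Qed.
Lemma rCN (a : R) : rC (- a) = - rC a. Proof. exact: (rmorphN (real_complex R)). Qed.
Lemma rCM (a b : R) : rC (a * b) = rC a * rC b. Proof. exact: (rmorphM (real_complex R)). Qed.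
Lemma rCV (a : R) : rC (a^-1) = (rC a)^-1. Proof. exact: (fmorphV (real_complex R)). Qed.
Lemma rC_nat n : rC (n%:R : R) = n%:R. Proof. exact: (rmorph_nat (real_complex R)). Qed.
Lemma rC_sum (I : Type) (r : seq I) (P : pred I) (F : I -> R) :
  rC (\sum_(i <- r | P i) F i) = \sum_(i <- r | P i) rC (F i).
Proof. exact: (rmorph_sum (real_complex R)). Qed.
Lemma ii : 'i * 'i = -1 :> C.
Proof. by rewrite -expr2 sqrCi. Qed.

Lemma conjc_rC (a : R) : conjc (rC a) = rC a.
Proof. exact: conjc_real. Qed.

Lemma conjc_i : conjc ('i : C) = - 'i.
Proof. by rewrite -complexiE /= -[RHS]/(Complex (- 0) (- 1)) oppr0. Qed.

Lemma conjc_mul (x y : C) : conjc (x * y) = conjc x * conjc y.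
Proof. exact: (rmorphM (@conjc R)). Qed.

Lemma adjmxD n (X Y : 'M[C]_n) : adjmx (X + Y) = adjmx X + adjmx Y.
Proof. by rewrite /adjmx map_mxD linearD. Qed.
Lemma adjmxZ n a (X : 'M[C]_n) : adjmx (a *: X) = conjc a *: adjmx X.
Proof. by rewrite /adjmx map_mxZ linearZ. Qed.
Lemma adjmxN n (X : 'M[C]_n) : adjmx (- X) = - adjmx X.
Proof. by rewrite /adjmx map_mxN linearN. Qed.
Lemma adjmx0 n : adjmx (0 : 'M[C]_n) = 0.
Proof. by rewrite /adjmx map_mx0 trmx0. Qed.
Lemma adjmxM n (X Y : 'M[C]_n) : adjmx (X *m Y) = adjmx Y *m adjmx X.
Proof. by rewrite /adjmx map_mxM trmx_mul. Qed.
Lemma adjmxK n (X : 'M[C]_n) : adjmx (adjmx X) = X.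
Proof. by apply/matrixP => a b; rewrite !mxE conjcK. Qed.
Lemma adjmx_sum n (I : Type) (r : seq I) (P : pred I) (F : I -> 'M[C]_n) :
  adjmx (\sum_(i <- r | P i) F i) = \sum_(i <- r | P i) adjmx (F i).
Proof. by apply: (big_morph (@adjmx R n)); [apply: adjmxD | apply: adjmx0]. Qed.
Lemma adjmx1 n : adjmx (1%:M : 'M[C]_n) = 1%:M.
Proof. by rewrite /adjmx map_mx1 trmx1. Qed.

Lemma adjmx_kron m n (A : 'M[C]_m) (B : 'M[C]_n) :
  adjmx (kron A B) = kron (adjmx A) (adjmx B).
Proof. by rewrite /adjmx /kron map_mxT trmx_tens. Qed.

Lemma kronDl m n (A A' : 'M[C]_m) (B : 'M[C]_n) :
  kron (A + A') B = kron A B + kron A' B.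
Proof. by apply/matrixP => i j; rewrite !mxE mulrDl. Qed.
Lemma kronDr m n (A : 'M[C]_m) (B B' : 'M[C]_n) :
  kron A (B + B') = kron A B + kron A B'.
Proof. by apply/matrixP => i j; rewrite !mxE mulrDr. Qed.
Lemma kronZl m n a (A : 'M[C]_m) (B : 'M[C]_n) :
  kron (a *: A) B = a *: kron A B.
Proof. by apply/matrixP => i j; rewrite !mxE mulrA. Qed.
Lemma kronZr m n a (A : 'M[C]_m) (B : 'M[C]_n) :
  kron A (a *: B) = a *: kron A B.
Proof. by apply/matrixP => i j; rewrite !mxE mulrCA. Qed.
Lemma kron0l m n (B : 'M[C]_n) : kron (0 : 'M_m) B = 0.
Proof. exact: tens0mx. Qed.
Lemma kron0r m n (A : 'M[C]_m) : kron A (0 : 'M_n) = 0.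
Proof. exact: tensmx0. Qed.
Lemma kronNl m n (A : 'M[C]_m) (B : 'M[C]_n) : kron (- A) B = - kron A B.
Proof. by rewrite -scaleN1r kronZl scaleN1r. Qed.
Lemma kronBl m n (A A' : 'M[C]_m) (B : 'M[C]_n) :
  kron (A - A') B = kron A B - kron A' B.
Proof. by rewrite kronDl kronNl. Qed.
Lemma kron_suml m n (I : Type) (r : seq I) (P : pred I) (F : I -> 'M[C]_m) (B : 'M[C]_n) :
  kron (\sum_(i <- r | P i) F i) B = \sum_(i <- r | P i) kron (F i) B.
Proof. by apply: (big_morph (fun A => kron A B)) => [A A'|]; rewrite ?kronDl ?kron0l. Qed.
Lemma kron_sumr m n (I : Type) (r : seq I) (P : pred I) (A : 'M[C]_m) (F : I -> 'M[C]_n) :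
  kron A (\sum_(i <- r | P i) F i) = \sum_(i <- r | P i) kron A (F i).
Proof. by apply: (big_morph (kron A)) => [B B'|]; rewrite ?kronDr ?kron0r. Qed.
Lemma kronM m n (A A' : 'M[C]_m) (B B' : 'M[C]_n) :
  kron A B *m kron A' B' = kron (A *m A') (B *m B').
Proof. exact: tensmx_mul. Qed.
Lemma kron11 m n : kron (1%:M : 'M[C]_m) (1%:M : 'M[C]_n) = 1%:M.
Proof.
apply/matrixP => a b; case: (mxtens_indexP a) => i j; case: (mxtens_indexP b) => k l.
rewrite tensmxE !mxE -natrM mulnb -xpair_eqE.
by rewrite (can_eq (@mxtens_indexK m n)).
Qed.
Lemma mxtrace_kron m n (A : 'M[C]_m) (B : 'M[C]_n) : \tr (kron A B) = \tr A * \tr B.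
Proof. by rewrite /mxtrace mulr_sum; apply: eq_bigr => i _; rewrite !mxE. Qed.

Section LieClosed.
Variables (n : nat) (P : 'M[C]_n -> Prop).
Hypothesis PL : lie_closed P.

Lemma lie_closed0 : P 0. Proof. by case: PL. Qed.
Lemma lie_closedD X Y : P X -> P Y -> P (X + Y). Proof. by case: PL => _ + _ _; apply. Qed.
Lemma lie_closedZ a X : P X -> P (rC a *: X). Proof. by case: PL => _ _ + _; apply. Qed.
Lemma lie_closed_bracket X Y : P X -> P Y -> P (X *m Y - Y *m X).
Proof. by case: PL => _ _ _; apply. Qed.
Lemma lie_closedN X : P X -> P (- X).
Proof. by move=> PX; rewrite -scaleN1r -rC1 -rCN; apply: lie_closedZ. Qed.
Lemma lie_closedB X Y : P X -> P Y -> P (X - Y).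
Proof. by move=> PX PY; apply: lie_closedD => //; apply: lie_closedN. Qed.
Lemma lie_closed_sum (I : eqType) (r : seq I) (Q : pred I) (F : I -> 'M[C]_n) :
  (forall i, Q i -> P (F i)) -> P (\sum_(i <- r | Q i) F i).
Proof. by move=> PF; apply: big_ind => //; [apply: lie_closed0 | apply: lie_closedD]. Qed.
Lemma lie_closed_unscale a X : a != 0 -> P (rC a *: X) -> P X.
Proof.
move=> a0 /(lie_closedZ a^-1).
by rewrite scalerA -rCM mulVf // rC1 scale1r.
Qed.
End LieClosed.

Lemma lie_gen_closed n (S : 'M[C]_n -> Prop) : lie_closed (lie_gen S).
Proof.
split=> [P PL _|X Y hX hY P PL SP|a X hX P PL SP|X Y hX hY P PL SP].
- exact: lie_closed0 PL.
- by apply: (lie_closedD PL); [apply: hX | apply: hY].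
- by apply: (lie_closedZ PL); apply: hX.
- by apply: (lie_closed_bracket PL); [apply: hX | apply: hY].
Qed.

Lemma lie_gen_in n (S : 'M[C]_n -> Prop) X : S X -> lie_gen S X.
Proof. by move=> SX P _; apply. Qed.

Lemma su_closed n : lie_closed (@su R n).
Proof.
split=> [|X Y [aX tX] [aY tY]|a X [aX tX]|X Y [aX tX] [aY tY]]; split.
- by rewrite adjmx0 oppr0.
- exact: mxtrace0.
- by rewrite adjmxD aX aY opprD.
- by rewrite mxtraceD tX tY addr0.
- by rewrite adjmxZ conjc_rC aX scalerN.
- by rewrite mxtraceZ tX mulr0.
- by rewrite adjmxD adjmxN !adjmxM aX aY !mulNmx !mulmxN !opprK opprB.
- by rewrite raddfB /= mxtrace_mulC subrr.
Qed.

End Scalars.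

(** * Pauli strings *)

Section Pauli.
Variable R : realType.
Local Notation C := R[i].

Definition pl (p : plabel) : pauli :=
  match p with
  | (false, false) => P0 | (true, false) => Px | (true, true) => Py | (false, true) => Pz
  end.

Definition sg (p : plabel) : 'M[C]_2 := pauli_mx R (pl p).

(** The listed pairs are the cyclic products [xy], [yz], [zx], which carry [+i]; the reversed ones
    carry [-i]. *)
Definition phase (p q : plabel) : C :=
  if omega p q then
    (if (p, q) \in [:: (lx, ly); (ly, lz); (lz, lx)] then 'i else - 'i)
  else 1.

Lemma sgM p q : sg p *m sg q = phase p q *: sg (p + q).
Proof.
apply/matrixP => a b; rewrite !mxE !big_ord_recl big_ord0 !mxE /phase.
have ii := @ii R.
case: a => [[|[|//]] ?]; case: b => [[|[|//]] ?];
  case: p => [[] []]; case: q => [[] []]; rewrite /omega /=;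
  rewrite ?(mulr1, mulr0, mul0r, mul1r, addr0, add0r, mulrN, mulNr, ii, opprK) //.
Qed.

Lemma phaseC p q : phase q p = (-1) ^+ omega p q * phase p q.
Proof.
by case: p => [[] []]; case: q => [[] []];
  rewrite /phase /omega /= ?(mulr1, mul1r, expr0, expr1, mulN1r, opprK).
Qed.

Lemma adj_sg p : adjmx (sg p) = sg p.
Proof.
apply/matrixP => a b; rewrite !mxE.
have h0 : conjc (0 : C) = 0 by exact: (rmorph0 (@conjc R)).
have h1 : conjc (1 : C) = 1 by exact: (rmorph1 (@conjc R)).
have hi := @conjc_i R.
have hn (x : C) : conjc (- x) = - conjc x by exact: (rmorphN (@conjc R)).
move: (@conjc R) h0 h1 hi hn => cj h0 h1 hi hn.
case: a => [[|[|//]] ?]; case: b => [[|[|//]] ?]; case: p => [[] []];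
  by rewrite -?val_eqE /=  ?(hn, hi, h0, h1, opprK).
Qed.

Lemma tr_sg p : \tr (sg p) = (p == 0)%:R * 2%:R.
Proof.
rewrite /mxtrace !big_ord_recl big_ord0 !mxE.
by case: p => [[] []]; rewrite -?val_eqE /= ?(addr0, mul0r, mul1r, subrr).
Qed.

(** The Pauli matrices are orthogonal for the trace form with squared norm 2, so the coefficient at
    [p] is half the trace of [sg p *m delta_mx u v], that is, half of [sg p v u]. *)
Lemma delta_sg (u v : 'I_2) :
  delta_mx u v = \sum_p (2%:R^-1 * sg p v u) *: sg p.
Proof.
have ii := @ii R.
apply/matrixP => a b; rewrite summxE.
have -> (F : plabel -> C) : \sum_p F p = F (true, true) + F (true, false) +
    (F (false, true) + F (false, false)).
  transitivity (\sum_(i : bool) \sum_(j : bool) F (i, j)); last by rewrite !big_bool.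
  by rewrite pair_bigA; apply: eq_bigr => -[].
have h2 : (2%:R^-1 + 2%:R^-1 : C) = 1 by rewrite -mulr2n -[_ *+ 2]mulr_natl mulfV ?pnatr_eq0.
rewrite !mxE; move: h2 ii; move: (2%:R^-1 : C) ('i : C) => h x h2 ii.
case: a => [[|[|//]] ?]; case: b => [[|[|//]] ?];
  case: u => [[|[|//]] ?]; case: v => [[|[|//]] ?]; rewrite -?val_eqE /=; ring: h2 ii.
Qed.

End Pauli.

Section Strings.
Variables (R : realType) (M : nat).
Local Notation C := R[i].
Local Notation lab := {ffun 'I_M -> plabel}.
Implicit Types (al be : lab).

Lemma bits_inj m a b : (a < 2 ^ m)%N -> (b < 2 ^ m)%N ->
  (forall j, (j < m)%N -> odd (a %/ 2 ^ j) = odd (b %/ 2 ^ j)) -> a = b.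
Proof.
elim: m a b => [|m IH] a b; first by rewrite expn0 !ltnS !leqn0 => /eqP -> /eqP ->.
rewrite expnS => ha hb hab.
have e0 : odd a = odd b by have := hab 0%N isT; rewrite expn0 !divn1.
rewrite -(odd_double_half a) -(odd_double_half b) e0; congr (_ + _.*2)%N.
apply: IH; rewrite -?divn2 ?ltn_divLR // 1?mulnC //.
by move=> j jm; rewrite -!divnMA -expnS; apply: hab.
Qed.

(** Binary expansion. It turns sums over basis indices of the accessor into products of one-qubit
    sums. *)
Lemma qbits_bij : bijective (fun a : 'I_(2 ^ M) => [ffun j : 'I_M => qbit j a]).
Proof.
apply: inj_card_bij => [a b /ffunP hab|]; last by rewrite card_ffun !card_ord.
apply: val_inj; apply: (@bits_inj M _ _ (ltn_ord a) (ltn_ord b)) => j jM.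
have e (c : bool) : val (inord c : 'I_2) = c :> nat by rewrite /= inordK //; case: c.
have := hab (Ordinal jM); rewrite !ffunE /qbit => /(congr1 val); rewrite !e.
by case: (odd _); case: (odd _).
Qed.

(** An arbitrary matrix is allowed on each qubit, so that products, traces and basis expansions of
    strings reduce to one qubit. *)
Definition tstring (F : 'I_M -> 'M[C]_2) : 'M[C]_(2 ^ M) :=
  \matrix_(a, b) \prod_j F j (qbit j a) (qbit j b).

Lemma sum_qbits (F : 'I_M -> 'I_2 -> C) :
  \sum_(a < 2 ^ M) \prod_j F j (qbit j a) = \prod_j \sum_(k : 'I_2) F j k.
Proof.
rewrite bigA_distr_bigA /= (reindex _ (onW_bij _ qbits_bij)).
by apply: eq_bigr => a _; apply: eq_bigr => j _; rewrite ffunE.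
Qed.

Lemma eq_tstring F G : F =1 G -> tstring F = tstring G.
Proof.
by move=> FG; apply/matrixP => a b; rewrite !mxE; apply: eq_bigr => j _; rewrite FG.
Qed.

Lemma tstringM F G : tstring F *m tstring G = tstring (fun j => F j *m G j).
Proof.
apply/matrixP => a b; rewrite !mxE.
transitivity (\sum_(k < 2 ^ M) \prod_j
  (F j (qbit j a) (qbit j k) * G j (qbit j k) (qbit j b))).
  by apply: eq_bigr => k _; rewrite big_split /= !mxE.
rewrite (sum_qbits (fun j k => F j (qbit j a) k * G j k (qbit j b))).
by apply: eq_bigr => j _; rewrite mxE.
Qed.

Lemma tstringZ c F : tstring (fun j => c j *: F j) = (\prod_j c j) *: tstring F.
Proof.
by apply/matrixP => a b; rewrite !mxE -big_split; apply: eq_bigr => j _; rewrite mxE.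
Qed.

Lemma tstring_sum (T : finType) (F : 'I_M -> T -> 'M[C]_2) :
  tstring (fun j => \sum_t F j t) = \sum_(f : {ffun 'I_M -> T}) tstring (fun j => F j (f j)).
Proof.
apply/matrixP => a b; rewrite !mxE summxE.
under eq_bigr do rewrite summxE.
by rewrite bigA_distr_bigA; apply: eq_bigr => f _; rewrite mxE.
Qed.

Lemma tr_tstring F : \tr (tstring F) = \prod_j \tr (F j).
Proof.
rewrite /mxtrace -(sum_qbits (fun j k => F j k k)).
by apply: eq_bigr => a _; rewrite mxE.
Qed.

Lemma adj_tstring F : adjmx (tstring F) = tstring (fun j => adjmx (F j)).
Proof.
apply/matrixP => a b; rewrite !mxE (rmorph_prod (@conjc R)).
by apply: eq_bigr => j _; rewrite !mxE.
Qed.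

Lemma delta_tstring a b :
  delta_mx a b = tstring (fun j => delta_mx (qbit j a) (qbit j b)).
Proof.
apply/matrixP => a' b'; rewrite !mxE.
have h (x y : 'I_(2 ^ M)) : \prod_j (qbit j x == qbit j y)%:R = (x == y)%:R :> C.
  case: eqVneq => [->|xy]; first by rewrite big1 // => j _; rewrite eqxx.
  have [/forallP e|/forallPn [j nj]] := boolP [forall j : 'I_M, qbit j x == qbit j y].
    case/eqP: xy; apply: (bij_inj qbits_bij); apply/ffunP => j; rewrite !ffunE.
    exact/eqP.
  by rewrite (bigD1 j) //= (negbTE nj) mul0r.
rewrite -mulnb natrM -!h -big_split; apply: eq_bigr => j _.
by rewrite mxE -mulnb natrM.
Qed.

Definition ps al : 'M[C]_(2 ^ M) := tstring (fun j => sg R (al j)).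

Definition Phase al be : C := \prod_j phase R (al j) (be j).

Lemma psM al be : ps al *m ps be = Phase al be *: ps (al + be).
Proof.
rewrite /ps tstringM -tstringZ; apply: eq_tstring => j.
by rewrite sgM ffunE.
Qed.

(** Every anticommuting site contributes [i] or [-i], every other site 1, and [Omega] is the parity
    of the number of anticommuting sites. The real factor [t] can later be divided out inside a real
    Lie algebra. *)
Lemma PhaseP al be : exists2 t : R, t != 0 &
  Phase al be = if Omega al be then 'i * rC t else rC t.
Proof.
(* [K] ties parity to phase, so that the xor and the product are handled by one induction. *)
pose K (b : bool) (z : C) := exists2 t : R, t != 0 & z = if b then 'i * rC t else rC t.
apply: (big_ind2 (K : bool -> C -> Prop)); first by exists 1; rewrite ?oner_neq0 ?rC1.
  move=> b z b' z' [t t0 ->] [t' t0' ->].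
  case: b; case: b'; rewrite /K /=.
  - exists (- (t * t')); first by rewrite oppr_eq0 mulf_neq0.
    by rewrite rCN rCM mulrACA ii mulN1r.
  - by exists (t * t'); rewrite ?mulf_neq0 // rCM mulrA.
  - by exists (t * t'); rewrite ?mulf_neq0 // rCM mulrCA.
  - by exists (t * t'); rewrite ?mulf_neq0 // rCM.
move=> j _; rewrite /K /phase; case: (omega _ _); last by exists 1; rewrite ?oner_neq0 ?rC1.
case: ifP => _; first by exists 1; rewrite ?oner_neq0 ?rC1 ?mulr1.
by exists (-1); rewrite ?oppr_eq0 ?oner_neq0 // rCN rC1 mulrN1.
Qed.

Lemma Phase_sym al be : Phase be al = (-1) ^+ Omega al be * Phase al be.
Proof.
rewrite /Omega (big_morph (fun b : bool => (-1) ^+ b : C) (@signr_addb C) (erefl _)).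
by rewrite -big_split; apply: eq_bigr => j _ /=; rewrite phaseC.
Qed.

Lemma ps_comm al be : ps be *m ps al = (-1) ^+ Omega al be *: (ps al *m ps be).
Proof. by rewrite !psM Phase_sym scalerA addrC. Qed.

Lemma ps0 : ps 0 = 1%:M.
Proof.
apply/matrixP => a b; rewrite !mxE.
have -> : (a == b)%:R = (delta_mx a a : 'M[C]_(2 ^ M)) a b by rewrite mxE eqxx eq_sym.
rewrite delta_tstring mxE; apply: eq_bigr => j _; rewrite ffunE !mxE eqxx /=.
by rewrite eq_sym.
Qed.

Lemma psK al : ps al *m ps al = 1%:M.
Proof.
rewrite psM addll ps0 /Phase big1 ?scale1r // => j _.
by rewrite /phase /omega andbC addbb.
Qed.

Lemma adj_ps al : adjmx (ps al) = ps al.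
Proof. by rewrite /ps adj_tstring; apply: eq_tstring => j; rewrite adj_sg. Qed.

Lemma tr_ps al : al != 0 -> \tr (ps al) = 0.
Proof.
move=> /label_neq0 [j aj].
by rewrite /ps tr_tstring (bigD1 j) //= tr_sg (negbTE aj) !mul0r.
Qed.

Definition ps_coef (a b : 'I_(2 ^ M)) al : C :=
  \prod_j (2%:R^-1 * sg R (al j) (qbit j b) (qbit j a)).

Lemma delta_ps a b : delta_mx a b = \sum_al ps_coef a b al *: ps al.
Proof.
rewrite delta_tstring.
under eq_tstring do rewrite delta_sg.
by rewrite tstring_sum; apply: eq_bigr => al _; rewrite tstringZ.
Qed.

Lemma pstring_ps (f : 'I_M -> pauli) al : (forall j, f j = pl (al j)) ->
  pstring R f = ps al.
Proof.
by move=> e; apply/matrixP => a b; rewrite !mxE; apply: eq_bigr => j _; rewrite e.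
Qed.

End Strings.

(** * Isolating string components *)

Section Filter.
Variables (R : realType) (N M : nat).
Local Notation C := R[i].
Local Notation lab := {ffun 'I_M -> plabel}.
Local Notation mx := 'M[C]_(N * 2 ^ M).
Implicit Types (al be ga : lab) (X : 'M[C]_N).

Definition kps X al : mx := kron X (ps R al).

(** Reordering the strings costs only a sign, so commuting strings leave a commutator of the system
    parts and anticommuting strings an anticommutator. *)
Lemma kps_bracket X Y al be :
  kps X al *m kps Y be - kps Y be *m kps X al =
  Phase R al be *: kps (X *m Y - (-1) ^+ Omega al be *: (Y *m X)) (al + be).
Proof.
rewrite /kps !kronM (ps_comm _ al be) psM !kronZr kronBl kronZl scalerBr.
by congr (_ - _); rewrite ?scalerA 1?mulrC.
Qed.

(* With [S = i 1 (x) sigma_ga] one has [S^2 = -1], hence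
   [S Y S = - ([S, [S, Y]] + 2 Y) / 2] stays in any Lie algebra containing [S] and [Y]. *)
Definition sandwich ga (Y : mx) : mx := kps 'i%:M ga *m Y *m kps 'i%:M ga.

(** As [sandwich ga] multiplies a string component [be] by [- (-1)^(Omega ga be)], this is the
    projection onto the components with [Omega ga be = b]. *)
Definition filter ga (b : bool) (Y : mx) : mx :=
  2%:R^-1 *: (Y - (-1) ^+ b *: sandwich ga Y).

Lemma sandwich_kps ga X be :
  sandwich ga (kps X be) = - (-1) ^+ Omega ga be *: kps X be.
Proof.
rewrite /sandwich /kps !kronM (ps_comm _ be ga) -scalemxAl.
rewrite -(mulmxA (ps R be)) psK mulmx1 kronZr.
rewrite mul_scalar_mx mul_mx_scalar scalerA ii kronZl scalerA.
by rewrite Omega_sym mulrN1.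
Qed.

Lemma filter_kps ga b X be :
  filter ga b (kps X be) = if b == Omega ga be then kps X be else 0.
Proof.
rewrite /filter sandwich_kps scalerA mulrN scaleNr opprK -signr_addb.
have [->|nb] := eqVneq b (Omega ga be).
  rewrite addbb expr0 scale1r -[X in X + X]scale1r -scalerDl scalerA.
  by rewrite mulVf ?scale1r // pnatr_eq0.
have -> : b (+) Omega ga be by case: (b) (Omega _ _) nb => [] [].
by rewrite expr1 scaleN1r subrr scaler0.
Qed.

Lemma filterD ga b Y Y' : filter ga b (Y + Y') = filter ga b Y + filter ga b Y'.
Proof.
rewrite /filter /sandwich mulmxDr mulmxDl -scalerDr; congr (_ *: _).
by rewrite scalerDr opprD addrACA.
Qed.

Lemma filterZ ga b a Y : filter ga b (a *: Y) = a *: filter ga b Y.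
Proof.
rewrite /filter /sandwich -scalemxAr -scalemxAl !scalerBr !scalerA.
by congr (_ *: _ - _ *: _); ring.
Qed.

Definition project (s : seq lab) al (Y : mx) : mx :=
  foldr (fun ga => filter ga (Omega ga al)) Y s.

Lemma projectD s al Y Y' : project s al (Y + Y') = project s al Y + project s al Y'.
Proof. by elim: s => //= ga s ->; rewrite filterD. Qed.

Lemma projectZ s al a Y : project s al (a *: Y) = a *: project s al Y.
Proof. by elim: s => //= ga s ->; rewrite filterZ. Qed.

Lemma project0 s al : project s al 0 = 0.
Proof. by rewrite -(scale0r 0) projectZ !scale0r. Qed.

Lemma project_sum s al (I : Type) (r : seq I) (P : pred I) F :
  project s al (\sum_(i <- r | P i) F i) = \sum_(i <- r | P i) project s al (F i).
Proof.
by apply: (big_morph (project s al)); [move=> ? ?; apply: projectD | apply: project0].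
Qed.

Lemma project_kps s al X be : project s al (kps X be) =
  if all (fun ga => Omega ga al == Omega ga be) s then kps X be else 0.
Proof.
elim: s => //= ga s ->; case: (all _ s); last first.
  by rewrite andbF -(scale0r 0) filterZ !scale0r.
by rewrite filter_kps andbT.
Qed.

(** By [label_eq] these test labels separate all strings, so [project singles al] keeps the
    component [al] alone. *)
Definition singles : seq lab :=
  [seq single j lx | j <- enum 'I_M] ++ [seq single j lz | j <- enum 'I_M].

Lemma project_singles al X be :
  project singles al (kps X be) = (al == be)%:R *: kps X be.
Proof.
rewrite project_kps; case: eqVneq => [->|nab].
  by rewrite (eq_all (a2 := predT)) ?all_predT ?scale1r // => ga; rewrite eqxx.
rewrite scale0r; case: ifP => // /allP h; case/eqP: nab.
apply: label_eq => j; apply/eqP/h; rewrite mem_cat; apply/orP; [left|right];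
  by apply/mapP; exists j; rewrite ?mem_enum.
Qed.

(** * Moving and combining string components inside a Lie-closed set *)

Section Closed.
Variable L : mx -> Prop.
Hypothesis LL : lie_closed L.

Lemma kps_commute X Y al be : ~~ Omega al be -> L (kps X al) -> L (kps Y be) ->
  L (kps (X *m Y - Y *m X) (al + be)).
Proof.
move=> /negbTE o hX hY; have := lie_closed_bracket LL hX hY.
have [t t0] := PhaseP R al be; rewrite kps_bracket o => ->.
by rewrite expr0 scale1r; apply: lie_closed_unscale.
Qed.

(** The phase of anticommuting strings is [i] times a real number; this [i] makes the anticommutator
    skew-Hermitian again. *)
Lemma kps_anticommute X Y al be : Omega al be -> L (kps X al) -> L (kps Y be) ->
  L (kps ('i *: (X *m Y + Y *m X)) (al + be)).
Proof.
move=> o hX hY; have := lie_closed_bracket LL hX hY.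
have [t t0] := PhaseP R al be; rewrite kps_bracket o => ->.
rewrite expr1 scaleN1r opprK mulrC -scalerA -/(kps _ _) /kps -kronZl.
exact: lie_closed_unscale.
Qed.

Lemma sandwich_closed ga Y : L (kps 'i%:M ga) -> L Y -> L (sandwich ga Y).
Proof.
move=> hS hY; rewrite /sandwich; set S := kps 'i%:M ga in hS *.
have SS : S *m S = - 1%:M.
  rewrite /S /kps kronM -scalar_mxM ii psK -[RHS]scaleN1r.
  by rewrite -scalemx1 kronZl; congr (_ *: _); apply: kron11.
have h2 := lie_closed_bracket LL hS (lie_closed_bracket LL hS hY).
have {}h2 : L (rC (- 2%:R^-1) *: (S *m (S *m Y - Y *m S) - (S *m Y - Y *m S) *m S) - Y).
  by apply: lie_closedB => //; apply: lie_closedZ.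
congr L : h2; rewrite mulmxBr mulmxBl !mulmxA SS -!mulmxA SS mulNmx mulmxN mul1mx mulmx1.
rewrite !mulmxA; move: (S *m Y *m S) => Z.
have -> : - Y - Z - (Z - - Y) = - 2%:R *: (Y + Z).
  by apply/matrixP => a b; rewrite !mxE; ring.
rewrite scalerA rCN rCV rC_nat mulrNN mulVf ?pnatr_eq0 // scale1r.
by rewrite addrC addKr.
Qed.

Lemma filter_closed ga b Y : L (kps 'i%:M ga) -> L Y -> L (filter ga b Y).
Proof.
move=> hS hY; rewrite /filter -(rC_nat R) -rCV; apply: lie_closedZ => //.
apply: lie_closedB => //; rewrite -[_ ^+ b](rmorph_sign (real_complex R)).
by apply: lie_closedZ => //; apply: sandwich_closed.
Qed.

Lemma project_closed s al Y : (forall ga, ga \in s -> L (kps 'i%:M ga)) ->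
  L Y -> L (project s al Y).
Proof.
move=> hs hY; elim: s hs => //= ga s IH hs; apply: filter_closed.
  by apply: hs; rewrite inE eqxx.
by apply: IH => be bs; apply: hs; rewrite inE bs orbT.
Qed.

Lemma kps_scalarD al be : Omega al be ->
  L (kps 'i%:M al) -> L (kps 'i%:M be) -> L (kps 'i%:M (al + be)).
Proof.
move=> o ha hb; have := kps_anticommute o ha hb.
rewrite -scalar_mxM ii -raddfD /= scale_scalar_mx.
have -> : 'i * (-1 - 1) = rC (- 2%:R) * 'i :> C by rewrite rCN rC_nat; ring.
rewrite -scale_scalar_mx /kps kronZl.
by apply: (lie_closed_unscale LL); rewrite oppr_eq0 pnatr_eq0.
Qed.

Hypothesis Lx : forall j, L (kps 'i%:M (single j lx)).
Hypothesis Ly : forall j, L (kps 'i%:M (single j ly)).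

Lemma single_lz_closed j : L (kps 'i%:M (single j lz)).
Proof.
have -> : lz = lx + ly by [].
rewrite singleD; apply: kps_scalarD => //.
by rewrite Omega_single ffunE eqxx.
Qed.

Lemma project_singles_closed al Y : L Y -> L (project singles al Y).
Proof.
apply: project_closed => ga; rewrite mem_cat => /orP[] /mapP [j _ ->] //.
exact: single_lz_closed.
Qed.

Hypothesis Lxx : forall j k : 'I_M, k = j.+1 :> nat ->
  L (kps 'i%:M (single j lx + single k lx)).

Lemma kps_scalar_all al : al != 0 -> L (kps 'i%:M al).
Proof.
apply: (@transvection_all _ (fun al => L (kps 'i%:M al))) => // al1 be1 h1 h2 o.
exact: kps_scalarD.
Qed.

(** Bracketing with an anticommuting [i 1 (x) sigma_ga] multiplies the system part by a nonzero real
    number only, so the label moves while [X] stays. *)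
Lemma kps_transport X al be : al != 0 -> be != 0 -> L (kps X al) -> L (kps X be).
Proof.
apply: (@transport _ (fun al => L (kps X al))) => {}al ga hX ga0 o.
have := kps_anticommute o hX (kps_scalar_all ga0).
rewrite mul_scalar_mx mul_mx_scalar -scalerDl scalerA.
have -> : 'i * ('i + 'i) = rC (- 2%:R) :> C by rewrite mulrDr ii rCN rC_nat; ring.
by rewrite /kps kronZl; apply: (lie_closed_unscale LL); rewrite oppr_eq0 pnatr_eq0.
Qed.

(** The identity string must be left out: ['i%:M] satisfies this property, whereas [i 1 (x) 1] is
    not traceless. *)
Definition nonlocal X : Prop := forall al, al != 0 -> L (kps X al).

Lemma nonlocal_scalar : nonlocal 'i%:M.
Proof. exact: kps_scalar_all. Qed.

Lemma nonlocal1 X al : al != 0 -> L (kps X al) -> nonlocal X.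
Proof. by move=> al0 hX be be0; apply: kps_transport hX. Qed.

Lemma nonlocalZ (a : R) X : nonlocal X -> nonlocal (rC a *: X).
Proof. by move=> hX al al0; rewrite /kps kronZl; apply: lie_closedZ => //; apply: hX. Qed.

Lemma nonlocal_unscale (a : R) X : a != 0 -> nonlocal (rC a *: X) -> nonlocal X.
Proof.
move=> a0 hX al al0; have := hX al al0; rewrite /kps kronZl.
exact: lie_closed_unscale.
Qed.

Lemma nonlocalD X Y : nonlocal X -> nonlocal Y -> nonlocal (X + Y).
Proof.
move=> hX hY al al0; rewrite /kps kronDl.
by apply: lie_closedD => //; [apply: hX | apply: hY].
Qed.

Lemma nonlocal_anti X Y : (0 < M)%N -> nonlocal X -> nonlocal Y ->
  nonlocal ('i *: (X *m Y + Y *m X)).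
Proof.
move=> M0 hX hY; pose j := Ordinal M0.
(* On one qubit [sigma_x] and [sigma_z] anticommute and their product is a nontrivial string. *)
apply: (@nonlocal1 _ (single j lx + single j lz)).
  by rewrite -singleD single_neq0.
apply: kps_anticommute; [|exact/hX/single_neq0|exact/hY/single_neq0].
by rewrite Omega_single ffunE eqxx.
Qed.

Lemma nonlocal_bracket X Y : (1 < M)%N -> nonlocal X -> nonlocal Y ->
  nonlocal (X *m Y - Y *m X).
Proof.
(* Commuting strings with a nontrivial product: [sigma_x] on two different qubits, which requires
   [M > 1]. *)
move=> M1 hX hY; pose j := Ordinal (ltnW M1); pose k := Ordinal M1.
have n0 : single j lx + single k lx != 0.
  by apply/eqP => /ffunP /(_ j); rewrite !ffunE.
apply: nonlocal1 n0 _.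
apply: kps_commute; [|exact/hX/single_neq0|exact/hY/single_neq0].
by rewrite Omega_single ffunE.
Qed.

(** A string commutes with itself and squares to the identity, so using it twice lands on the label
    0. *)
Lemma local_bracket X Y : (0 < M)%N -> nonlocal X -> nonlocal Y ->
  L (kps (X *m Y - Y *m X) 0).
Proof.
move=> M0 hX hY; have j0 := single_neq0 (Ordinal M0) (isT : lx != 0).
rewrite -(addll (single (Ordinal M0) lx)).
by apply: kps_commute; [rewrite Omega_self | exact: hX | exact: hY].
Qed.

Lemma nonlocal_closed : (1 < M)%N -> lie_closed nonlocal.
Proof.
move=> M1; split.
- by move=> al _; rewrite /kps kron0l; apply: lie_closed0 LL.
- exact: nonlocalD.
- exact: nonlocalZ.
- by move=> X Y; apply: nonlocal_bracket.
Qed.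

End Closed.

Lemma local_closed (L : mx -> Prop) : lie_closed L -> lie_closed (fun X => L (kps X 0)).
Proof.
move=> LL; split.
- by rewrite /kps kron0l; apply: lie_closed0 LL.
- by move=> X Y; rewrite /kps kronDl; apply: lie_closedD LL _ _.
- by move=> a X; rewrite /kps kronZl; apply: lie_closedZ LL _ _.
- move=> X Y hX hY; rewrite -(addr0 0); apply: kps_commute => //.
  by rewrite Omega0r.
Qed.

End Filter.

(** * String expansion of operators on the full system *)

Section Span.
Variables (R : realType) (N M : nat).
Local Notation C := R[i].
Local Notation lab := {ffun 'I_M -> plabel}.
Local Notation mx := 'M[C]_(N * 2 ^ M).

(** [Y] is cut into [N x N] blocks indexed by pairs of accessor basis states, and each accessor
    matrix unit is expanded in Pauli strings. *)
Lemma kps_spanning (Y : mx) : exists A : lab -> 'M[C]_N, Y = \sum_al kps (A al) al.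
Proof.
pose blk b b' : 'M[C]_N :=
  \matrix_(a, a') Y (mxtens_index (a, b)) (mxtens_index (a', b')).
exists (fun al => \sum_b \sum_b' ps_coef R b b' al *: blk b b').
have -> : Y = \sum_b \sum_b' kron (blk b b') (delta_mx b b').
  apply/matrixP => r s; case: (mxtens_indexP r) => a b; case: (mxtens_indexP s) => a' b'.
  rewrite summxE (bigD1 b) //= summxE (bigD1 b') //= tensmxE !mxE !eqxx mulr1.
  rewrite !big1 ?addr0 // => [i ib|i ib]; first rewrite summxE big1 // => k _.
    by rewrite tensmxE !mxE (eq_sym b) (negbTE ib) mulr0.
  by rewrite tensmxE !mxE (eq_sym b') (negbTE ib) andbF mulr0.
rewrite /kps; under [RHS]eq_bigr => al _ do rewrite kron_suml.
rewrite [RHS]exchange_big /=; apply: eq_bigr => b _.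
under [RHS]eq_bigr => al _ do rewrite kron_suml.
rewrite [RHS]exchange_big /=; apply: eq_bigr => b' _.
rewrite delta_ps kron_sumr; apply: eq_bigr => al _.
by rewrite kronZl kronZr.
Qed.

Lemma adj_kps (X : 'M[C]_N) al : adjmx (kps X al : mx) = kps (adjmx X) al.
Proof. by rewrite /kps adjmx_kron adj_ps. Qed.

Lemma tr_kps (X : 'M[C]_N) (al : lab) :
  \tr (kps X al) = (al == 0)%:R * (\tr X * (2 ^ M)%:R).
Proof.
rewrite /kps mxtrace_kron; case: eqVneq => [->|al0]; last by rewrite tr_ps // mul0r mulr0.
by rewrite ps0 mxtrace1 mul1r.
Qed.

Lemma su_kps_decomp (Y : mx) : su Y -> exists A : lab -> 'M[C]_N,
  [/\ Y = \sum_al kps (A al) al, forall al, adjmx (A al) = - A al & \tr (A 0) = 0].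
Proof.
move=> [aY tY]; have [B eY] := kps_spanning Y.
(* Taking skew-Hermitian parts of the coefficients is harmless because [Y = (Y - Y^dagger) / 2];
   uniqueness of the expansion is thereby avoided. *)
exists (fun al => 2%:R^-1 *: (B al - adjmx (B al))).
have h2 : conjc (2%:R^-1 : C) = 2%:R^-1.
  by rewrite -(rC_nat R) -rCV conjc_rC.
have eY' : Y = \sum_al kps (2%:R^-1 *: (B al - adjmx (B al))) al.
  transitivity (2%:R^-1 *: (Y - adjmx Y)).
    by rewrite aY opprK -[X in X + X]scale1r -scalerDl scalerA mulVf ?scale1r // pnatr_eq0.
  rewrite eY adjmx_sum -sumrB scaler_sumr; apply: eq_bigr => al _.
  by rewrite adj_kps /kps kronZl kronBl.
split=> // [al|].
  by rewrite adjmxZ h2 adjmxD adjmxN adjmxK -scalerN opprB addrC.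
(* Only the identity string has a trace, so [tr Y] is [2^M] times the trace of the coefficient at
   0. *)
move: tY; rewrite eY' raddf_sum /= (bigD1 (0 : lab)) //= big1 => [|al al0].
  rewrite addr0 tr_kps eqxx mul1r => /eqP.
  by rewrite mulf_eq0 pnatr_eq0 expn_eq0 /= orbF => /eqP.
by rewrite tr_kps (negbTE al0) mul0r.
Qed.

End Span.

Section Matrices.
Variables (R : realType) (N : nat).
Local Notation e := (@emx R N).

Lemma emxM j k k' l : e j k *m e k' l = ((k == k') && (k < N)%N)%:R *: e j l.
Proof.
apply/matrixP => a b; rewrite !mxE; have [kN|kN] := ltnP k N; last first.
  rewrite andbF mul0r big1 // => i _; rewrite !mxE.
  have -> : (i == k :> nat) = false by have := ltn_ord i; lia.
  by rewrite andbF mul0r.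
rewrite (bigD1 (Ordinal kN)) //= !mxE /= eqxx andbT big1 ?addr0.
  by rewrite -!natrM !mulnb; congr (_ %:R); case: (_ == j); case: (k == k'); case: (_ == l).
move=> i ik; rewrite !mxE; have -> : (i == k :> nat) = false.
  by apply/negbTE; move: ik; rewrite -val_eqE.
by rewrite andbF mul0r.
Qed.

Lemma adj_emx j k : adjmx (e j k) = e k j.
Proof. by apply/matrixP => a b; rewrite !mxE (rmorph_nat (@conjc R)) andbC. Qed.

Lemma tr_emx j k : j != k -> \tr (e j k) = 0.
Proof.
move=> jk; rewrite /mxtrace big1 // => a _; rewrite mxE.
by case: eqP => // ->; rewrite (negbTE jk).
Qed.

Lemma tr_emx1 j : (j < N)%N -> \tr (e j j) = 1.
Proof.
move=> jN; rewrite /mxtrace (bigD1 (Ordinal jN)) //= big1 ?addr0 ?mxE ?eqxx // => a.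
by rewrite -val_eqE /= mxE => /negbTE ->.
Qed.

Lemma tr_HS (E : 'I_N -> R) : \tr (HS E) = rC (\sum_j E j).
Proof.
rewrite /HS raddf_sum rC_sum; apply: eq_bigr => j _ /=.
by rewrite mxtraceZ tr_emx1 ?mulr1.
Qed.

Lemma adj_HS (E : 'I_N -> R) : adjmx (HS E) = HS E.
Proof.
rewrite /HS adjmx_sum; apply: eq_bigr => j _.
by rewrite adjmxZ conjc_rC adj_emx.
Qed.

Lemma adj_sS j k : adjmx (sS R N j k) = sS R N j k.
Proof.
case: k; rewrite /= /yS /xS ?adjmxZ adjmxD ?adjmxN !adj_emx 1?addrC //.
by rewrite conjc_i scaleNr -scalerN opprD opprK addrC.
Qed.

Lemma tr_sS j k : \tr (sS R N j k) = 0.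
Proof.
have h1 : \tr (e j j.+1) = 0 by apply: tr_emx; lia.
have h2 : \tr (e j.+1 j) = 0 by apply: tr_emx; lia.
case: k; rewrite /= /yS /xS ?mxtraceZ ?raddfB ?mxtraceD /= h1 h2 ?subrr ?addr0 ?mulr0 //.
Qed.

End Matrices.

(** * The drift Hamiltonian *)

Section Hamiltonian.
Variables (R : realType) (N M : nat).
Local Notation C := R[i].
Local Notation lab := {ffun 'I_M -> plabel}.

Definition lab_xx (j : nat) : lab :=
  [ffun k : 'I_M => if (nat_of_ord k == j) || (nat_of_ord k == j.+1) then lx else 0].
Definition lab_xy (f : {ffun 'I_M -> bool}) : lab := [ffun k => if f k then ly else lx].

Lemma sigma1_ps (p : plabel) (j : 'I_M) : sigma1 R (pl p) j = ps R (single j p).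
Proof. by apply: pstring_ps => k; rewrite ffunE; case: eqP. Qed.

Lemma sigmaxx_ps j : sigmaxx R M j = ps R (lab_xx j).
Proof. by apply: pstring_ps => k; rewrite ffunE; case: ifP. Qed.

Lemma pstring_xy_ps f : pstring_xy R f = ps R (lab_xy f).
Proof. by apply: pstring_ps => k; rewrite ffunE; case: (f k). Qed.

Lemma lab_xxE (j k : 'I_M) : k = j.+1 :> nat -> lab_xx j = single j lx + single k lx.
Proof.
move=> ek; apply/ffunP => i; rewrite !ffunE -!val_eqE /= ek.
by case: eqVneq => [->|_]; rewrite ?add0r // ltn_eqF ?addr0.
Qed.

Lemma H0E (E : 'I_N -> R) d (hw : 'I_M -> R) c g :
  H0 E d hw c g = kps (HS E + \sum_(j < N.-1) rC (d j) *: xS R N j) 0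
    + \sum_(j < M) rC (hw j) *: kps 1%:M (single j lz)
    + \sum_(j < M.-1) rC (c j) *: kps 1%:M (lab_xx j)
    + \sum_f kps (\sum_(j < N.-1) \sum_k rC (g j k f) *: sS R N j k) (lab_xy f).
Proof.
rewrite /H0 /kps ps0 kronDl -!addrA; congr (_ + _); congr (_ + _).
  by rewrite kron_suml; apply: eq_bigr => j _; rewrite kronZl.
rewrite /HA kronDr !kron_sumr -addrA; congr (_ + _).
  by apply: eq_bigr => j _; rewrite kronZr -[Pz]/(pl lz) sigma1_ps.
congr (_ + _); first by apply: eq_bigr => j _; rewrite kronZr sigmaxx_ps.
under eq_bigr => j _ do rewrite exchange_big.
rewrite exchange_big /=; apply: eq_bigr => f _.
rewrite kron_suml; apply: eq_bigr => j _; rewrite kron_suml.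
by apply: eq_bigr => k _; rewrite kronZl pstring_xy_ps.
Qed.

Lemma lab_xy_inj : injective lab_xy.
Proof.
move=> f f' /ffunP ff; apply/ffunP => j; have := ff j; rewrite !ffunE.
by case: (f j); case: (f' j).
Qed.

Lemma lab_xy_neq0 f (j : 'I_M) : lab_xy f j != 0.
Proof. by rewrite ffunE; case: (f j). Qed.

Lemma lab_xx_inj j j' : (j < M.-1)%N -> (j' < M.-1)%N -> lab_xx j = lab_xx j' -> j = j'.
Proof.
move=> jM jM' h.
have j1 : (j < M)%N by lia.
have j2 : (j.+1 < M)%N by lia.
have := congr1 (fun f : lab => f (Ordinal j1)) h.
have := congr1 (fun f : lab => f (Ordinal j2)) h.
rewrite !ffunE /= !eqxx orbT /=.
case: ifP => // /orP[] /eqP a _; case: ifP => // /orP[] /eqP b _; lia.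
Qed.

(** With at least three qubits some qubit lies outside [j] and [j.+1]; the first string is trivial
    there, the second nowhere. *)
Lemma lab_xx_neq_xy j f : (2 < M)%N -> lab_xx j != lab_xy f.
Proof.
move=> M2; have [k k1] : exists k : 'I_M, (nat_of_ord k != j) && (nat_of_ord k != j.+1).
  have [->|j0] := eqVneq j 0%N; first by exists (Ordinal M2).
  have M0 : (0 < M)%N by lia.
  by exists (Ordinal M0); rewrite /=; lia.
apply: contraNneq (lab_xy_neq0 f k) => <-; rewrite ffunE.
by move: k1 => /andP[/negbTE -> /negbTE ->].
Qed.

Lemma lab_xx_neq_single j (k : 'I_M) : (j < M.-1)%N -> lab_xx j != single k lz.
Proof.
move=> jM; have j1 : (j < M)%N by lia.
apply/eqP => /ffunP /(_ (Ordinal j1)); rewrite !ffunE /= eqxx /=.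
by case: ifP.
Qed.

Lemma lab_xx_neq0 j : (j < M.-1)%N -> lab_xx j != 0.
Proof.
move=> jM; have j1 : (j < M)%N by lia.
by apply/eqP => /ffunP /(_ (Ordinal j1)); rewrite !ffunE /= eqxx.
Qed.

Lemma lab_xy_neq_single f (k : 'I_M) : lab_xy f != single k lz.
Proof.
by apply/eqP => /ffunP /(_ k); rewrite !ffunE eqxx; case: (f k).
Qed.

Section Project.
Variables (E : 'I_N -> R) (d : nat -> R) (hw : 'I_M -> R) (c : nat -> R).
Variable g : nat -> bool -> {ffun 'I_M -> bool} -> R.
Hypothesis HM : (2 < M)%N.

Lemma project_H0_xx j : (j < M.-1)%N ->
  project (singles M) (lab_xx j) (H0 E d hw c g) = rC (c j) *: kps 1%:M (lab_xx j).
Proof.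
move=> jM; rewrite H0E !projectD !project_sum project_singles.
rewrite (negbTE (lab_xx_neq0 jM)) scale0r add0r.
rewrite [X in X + _ + _]big1 ?add0r; last first.
  move=> k _; rewrite projectZ project_singles (negbTE (lab_xx_neq_single _ jM)).
  by rewrite scale0r scaler0.
rewrite [X in _ + X]big1 ?addr0; last first.
  by move=> f _; rewrite project_singles (negbTE (lab_xx_neq_xy _ _ HM)) scale0r.
rewrite (bigD1 (Ordinal jM)) //= projectZ project_singles eqxx scale1r big1 ?addr0 //.
move=> k kj; rewrite projectZ project_singles.
case: eqP => [/(lab_xx_inj jM (ltn_ord k)) jk|_]; last by rewrite scale0r scaler0.
by case/eqP: kj; apply: val_inj.
Qed.

Lemma project_H0_xy f : project (singles M) (lab_xy f) (H0 E d hw c g) =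
  kps (\sum_(j < N.-1) \sum_k rC (g j k f) *: sS R N j k) (lab_xy f).
Proof.
rewrite H0E !projectD !project_sum project_singles.
have -> : (lab_xy f == 0) = false.
  have M0 : (0 < M)%N by lia.
  by apply: contraNF (lab_xy_neq0 f (Ordinal M0)) => /eqP ->; rewrite ffunE.
rewrite scale0r add0r [X in X + _ + _]big1 ?add0r; last first.
  move=> k _; rewrite projectZ project_singles (negbTE (lab_xy_neq_single _ _)).
  by rewrite scale0r scaler0.
rewrite [X in X + _]big1 ?add0r; last first.
  move=> k _; rewrite projectZ project_singles eq_sym (negbTE (lab_xx_neq_xy _ _ HM)).
  by rewrite scale0r scaler0.
rewrite (bigD1 f) //= project_singles eqxx scale1r [X in _ + X]big1 ?addr0 // => f' f'f.
rewrite project_singles; case: eqP => [/lab_xy_inj ff|_]; last by rewrite scale0r.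
by rewrite ff eqxx in f'f.
Qed.

(** Every term is [i] times a Hermitian matrix. Traces can come only from the identity string, where
    [\sum_j E j = 0] and the tracelessness of [x_j] remove them. *)
Lemma su_ctrl_gens (HE : \sum_j E j = 0) X : ctrl_gens (H0 E d hw c g) X -> su X.
Proof.
have su_i n (H : 'M[C]_n) : adjmx H = H -> \tr H = 0 -> su ('i *: H).
  by move=> aH tH; split; rewrite ?adjmxZ ?conjc_i ?aH ?scaleNr // mxtraceZ tH mulr0.
have su_kps (A : 'M[C]_N) (al : lab) : adjmx A = A -> \tr A = 0 \/ al != 0 ->
    su ('i *: kps A al).
  move=> aA h; apply: su_i; first by rewrite adj_kps aA.
  by rewrite tr_kps; case: h => [->|/negbTE ->]; rewrite ?mul0r ?mulr0.
have su1 (j : 'I_M) (p : plabel) : p != 0 -> su ('i *: kps (1%:M : 'M[C]_N) (single j p)).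
  by move=> p0; apply: su_kps; rewrite ?adjmx1 //; right; apply: single_neq0.
case=> [->|[j [->|->]]]; last 2 first.
- by rewrite -[Px]/(pl lx) sigma1_ps; apply: (su1 j).
- by rewrite -[Py]/(pl ly) sigma1_ps; apply: (su1 j).
have SC := su_closed R (N * 2 ^ M).
rewrite H0E !scalerDr !scaler_sumr; do !apply: (lie_closedD SC).
- apply: su_kps; last left.
    rewrite adjmxD adj_HS adjmx_sum; congr (_ + _); apply: eq_bigr => j _.
    by rewrite adjmxZ conjc_rC (adj_sS _ _ j false).
  rewrite mxtraceD tr_HS HE rC0 add0r raddf_sum big1 // => j _.
  by rewrite /= mxtraceZ (tr_sS _ _ j false) mulr0.
- apply: (lie_closed_sum SC) => j _; rewrite scalerA mulrC -scalerA.
  by apply: (lie_closedZ SC); apply: su1.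
- apply: (lie_closed_sum SC) => j _; rewrite scalerA mulrC -scalerA.
  apply: (lie_closedZ SC); apply: su_kps; first exact: adjmx1.
  by right; apply: lab_xx_neq0.
- apply: (lie_closed_sum SC) => f _; apply: su_kps; last left.
    rewrite adjmx_sum; apply: eq_bigr => j _; rewrite adjmx_sum.
    by apply: eq_bigr => k _; rewrite adjmxZ conjc_rC adj_sS.
  rewrite raddf_sum big1 // => j _; rewrite raddf_sum big1 // => k _.
  by rewrite /= mxtraceZ tr_sS mulr0.
Qed.

End Project.
End Hamiltonian.

(** * Controllability *)

(** Meant for [yS], which has the form ['i *: B]. *)
Lemma bracket_ixy (R : realType) n (A B : 'M[R[i]]_n) :
  ('i *: A) *m ('i *: ('i *: B)) - ('i *: ('i *: B)) *m ('i *: A) =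
  'i *: (B *m A - A *m B).
Proof.
rewrite !scalerA ii scaleN1r mulmxN mulNmx -scalemxAl -scalemxAr scalerBr opprK.
by rewrite addrC.
Qed.

Section MatrixUnits.
Variables (R : realType) (N : nat).
Local Notation e := (@emx R N).
Variables j k : nat.
Hypotheses (jk : j != k) (jN : (j < N)%N) (kN : (k < N)%N).

Let kj : (k == j) = false. Proof. by rewrite eq_sym (negbTE jk). Qed.

Lemma mul_xx : (e j k + e k j) *m (e j k + e k j) = e j j + e k k.
Proof.
rewrite mulmxDl !mulmxDr !emxM !eqxx !kj (negbTE jk) !jN !kN /=.
by rewrite !scale0r !scale1r add0r addr0.
Qed.

Lemma mul_xy : (e j k + e k j) *m (e j k - e k j) = e k k - e j j.
Proof.
rewrite mulmxDl !mulmxBr !emxM !eqxx !kj (negbTE jk) !jN !kN /=.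
by rewrite !scale0r !scale1r sub0r subr0 addrC.
Qed.

Lemma mul_yx : (e j k - e k j) *m (e j k + e k j) = e j j - e k k.
Proof.
rewrite mulmxBl !mulmxDr !emxM !eqxx !kj (negbTE jk) !jN !kN /=.
by rewrite !scale0r !scale1r add0r addr0.
Qed.

Lemma bracket_ey :
  e j j *m (e j k - e k j) - (e j k - e k j) *m e j j = e j k + e k j.
Proof.
rewrite mulmxBl mulmxBr !emxM !eqxx !kj (negbTE jk) !jN !kN /=.
by rewrite !scale0r !scale1r subr0 sub0r opprK.
Qed.

End MatrixUnits.

Arguments mul_xx {R N j k}.
Arguments mul_xy {R N j k}.
Arguments mul_yx {R N j k}.
Arguments bracket_ey {R N j k}.

Section Controllability.
Variables (R : realType) (N M : nat).
Local Notation C := R[i].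
Local Notation mx := 'M[C]_(N * 2 ^ M).
Local Notation e := (@emx R N).
Variable L : mx -> Prop.
Hypothesis LL : lie_closed L.
Hypotheses (HN : (1 < N)%N) (HM : (1 < M)%N).
Hypothesis Lx : forall j, L (kps 'i%:M (single j lx)).
Hypothesis Ly : forall j, L (kps 'i%:M (single j ly)).
Hypothesis Lxx : forall j k : 'I_M, k = j.+1 :> nat ->
  L (kps 'i%:M (single j lx + single k lx)).
Hypothesis nonlocal_sS : forall j b, (j < N.-1)%N -> nonlocal L ('i *: sS R N j b).
Variables (E : 'I_N -> R) (d : nat -> R).
Hypothesis HE : \sum_j E j = 0.
Hypothesis gen : generates_su (fun X : 'M[C]_N =>
             X = 'i *: HS E \/
             X = 'i *: \sum_(j < N.-1) rC (d j) *: @xS R N j).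

Let M0 : (0 < M)%N := ltnW HM.
Let nlZ := nonlocalZ LL.
Let nlD := nonlocalD LL.

(** For [u = e l l] and [v = e l.+1 l.+1], the operation [i {X, Y}] applied to [i x_l] twice gives
    [-2i (u + v)], and [[i x_l, i y_l]] gives [2i (u - v)]. Their combinations yield [4i u] and
    [4i v]. *)
Lemma nonlocal_emx j : (j < N)%N -> nonlocal L ('i *: e j j).
Proof.
have nonlocal_eq (X Y : 'M[C]_N) : X = Y -> nonlocal L X -> nonlocal L Y by move=> ->.
have step l (b : bool) : (l < N.-1)%N ->
    nonlocal L ('i *: (if b then e l.+1 l.+1 else e l l)).
  move=> lN; have l1 : (l < N)%N by lia.
  have l2 : (l.+1 < N)%N by lia.
  have ll : l != l.+1 by lia.
  have hx := nonlocal_sS false lN; have hy := nonlocal_sS true lN.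
  have hxx := nonlocal_anti LL Lx Ly Lxx M0 hx hx.
  have hxy := nonlocal_bracket LL Lx Ly Lxx HM hx hy.
  rewrite /= /xS -scalemxAl -scalemxAr (mul_xx ll l1 l2) !scalerA ii in hxx.
  rewrite /= /xS /yS bracket_ixy (mul_xy ll l1 l2) (mul_yx ll l1 l2) in hxy.
  apply: (@nonlocal_unscale _ _ _ _ LL 4%:R); first by rewrite pnatr_eq0.
  have := nlD (nlZ (if b then -1 else 1) hxy) (nlZ (-1) hxx).
  apply: nonlocal_eq; move: (e l l) (e l.+1 l.+1) => u v.
  move: ('i : C) => x.
  rewrite rC_nat; case: b; rewrite ?rCN ?rC1; apply/matrixP => s t; rewrite !mxE; ring.
move=> jN; have [j1|j1] := ltnP j N.-1; first exact: (step j false).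
(* The last basis index starts no pair [(l, l.+1)], so it is reached as the upper end of the last
   one. *)
have -> : j = N.-2.+1 by lia.
by apply: (step N.-2 true); lia.
Qed.

Lemma nonlocal_su X : su X -> nonlocal L X.
Proof.
move=> /gen; apply; first exact: nonlocal_closed.
have NC : lie_closed (nonlocal L) by exact: nonlocal_closed.
move=> Y [] ->.
  rewrite /HS scaler_sumr; apply: (lie_closed_sum NC) => j _.
  by rewrite scalerA mulrC -scalerA; apply: nlZ; apply: nonlocal_emx.
rewrite scaler_sumr; apply: (lie_closed_sum NC) => j _.
by rewrite scalerA mulrC -scalerA; apply: nlZ; apply: (nonlocal_sS false).
Qed.

Lemma skew_imaginary (z : C) : conjc z = - z -> z = 'i * rC (complex.Im z).
Proof.
case: z => a b; rewrite -complexiE => -[ea]; rewrite /= /rC; simpc.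
by congr Complex; lra.
Qed.

(** The trace part of a skew-Hermitian matrix is a real multiple of ['i%:M], which is covered by
    [nonlocal_scalar]; the rest lies in [su]. *)
Lemma nonlocal_skew X : adjmx X = - X -> nonlocal L X.
Proof.
move=> aX; have N0 : (N%:R : C) != 0 by rewrite pnatr_eq0; lia.
have cN : conjc (N%:R^-1 : C) = N%:R^-1 by rewrite -(rC_nat R) -rCV conjc_rC.
pose z := \tr X / N%:R.
have zi : conjc z = - z.
  rewrite /z conjc_mul cN -mulNr; congr (_ * _).
  rewrite -raddfN -aX /mxtrace (rmorph_sum (@conjc R)).
  by apply: eq_bigr => i _; rewrite !mxE.
have -> : X = (X - z%:M) + z%:M by rewrite subrK.
apply: nlD.
  apply: nonlocal_su; split.
    rewrite adjmxD adjmxN aX -scalemx1 adjmxZ adjmx1 zi scaleNr opprK.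
    by rewrite opprB addrC.
  by rewrite raddfB /= mxtrace_scalar -mulr_natr /z mulfVK // subrr.
rewrite (skew_imaginary zi) mulrC -scale_scalar_mx.
by apply: nlZ; apply: nonlocal_scalar.
Qed.

Lemma local_su X : su X -> L (kps X 0).
Proof.
have LC := local_closed LL.
have skew_y a b : adjmx (e a b - e b a) = - (e a b - e b a).
  by rewrite adjmxD adjmxN !adj_emx opprB.
have skew_x a b : adjmx ('i *: (e a b + e b a)) = - ('i *: (e a b + e b a)).
  by rewrite adjmxZ adjmxD !adj_emx conjc_i scaleNr addrC.
move=> /gen /(_ (fun X => L (kps X 0)) LC); apply => Y [] ->.
  have N0 : (0 < N)%N by lia.
  (* Since the energies sum to 0, [e 0 0] may be subtracted in every term, which leaves traceless
     differences. *)
  have -> : 'i *: HS E = \sum_(j < N) rC (E j) *: ('i *: (e j j - e 0 0)).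
    under [RHS]eq_bigr => j _ do rewrite !scalerBr.
    rewrite sumrB -[X in _ = _ - X]scaler_suml -rC_sum HE rC0 scale0r subr0.
    by rewrite /HS scaler_sumr; apply: eq_bigr => j _; rewrite !scalerA mulrC.
  apply: (lie_closed_sum LC) => j _; apply: (lie_closedZ LC).
  have [->|j0] := eqVneq (nat_of_ord j) 0%N.
    by rewrite subrr scaler0; apply: lie_closed0 LC.
  have j0' : 0%N != j by rewrite eq_sym.
  apply: (lie_closed_unscale LC (a := 2%:R)); first by rewrite pnatr_eq0.
  (* The bracket of [i (e 0 j + e j 0)] with [e 0 j - e j 0] is twice [i (e j j - e 0 0)]. *)
  have := local_bracket LL M0 (nonlocal_skew (skew_x 0%N j)) (nonlocal_skew (skew_y 0%N j)).
  rewrite -scalemxAl -scalemxAr -scalerBr.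
  rewrite (mul_xy j0' N0 (ltn_ord j)) (mul_yx j0' N0 (ltn_ord j)).
  congr (L (kps _ _)); rewrite opprB rC_nat !scalerA mulrC -scalerA.
  by congr (_ *: _); rewrite scaler_nat mulr2n.
rewrite scaler_sumr; apply: (lie_closed_sum LC) => j _.
rewrite scalerA mulrC -scalerA; apply: (lie_closedZ LC).
have j1 : (j < N)%N by have := ltn_ord j; lia.
have j2 : (j.+1 < N)%N by have := ltn_ord j; lia.
have jj : nat_of_ord j != j.+1 by lia.
(* The bracket of [i e j j] with [e j j.+1 - e j.+1 j] is [i x_j]. *)
have := local_bracket LL M0 (nonlocal_emx j1) (nonlocal_skew (skew_y j j.+1)).
by rewrite -scalemxAl -scalemxAr -scalerBr (bracket_ey jj j1 j2).
Qed.

Lemma su_sub_closed X : su X -> L X.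
Proof.
move=> /su_kps_decomp [A [-> aA tA]]; apply: (lie_closed_sum LL) => al _.
have [->|al0] := eqVneq al 0; first exact: local_su.
exact: nonlocal_skew.
Qed.

End Controllability.

(** * Inverting the coupling matrix *)

Section ConditionTwo.
Variables (R : realType) (n : nat).

Lemma col_index_subproof (j : 'I_n) (k : bool) : (k * n + j < 2 * n)%N.
Proof. by have := ltn_ord j; case: k; lia. Qed.

(** The column order of [Gmx]: all [x] couplings first, then the [y] couplings shifted by [n]. *)
Definition col_index j k := Ordinal (col_index_subproof j k).

Lemma col_index_inj j j' k k' : col_index j k = col_index j' k' -> j = j' /\ k = k'.
Proof.
move=> /(congr1 val) /=; have := ltn_ord j; have := ltn_ord j'.
by case: k; case: k' => /= h h' e0; split => //; try (apply: val_inj => /=); lia.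
Qed.

End ConditionTwo.

(** The inner sums are the rows of [G] applied to the vector of all [s j k]; a row of the inverse
    matrix recovers a single entry. *)
Lemma Gmx_invert (R : realType) (N M : nat) (V : lmodType R[i])
    (g : nat -> bool -> {ffun 'I_M -> bool} -> R)
    (beta : 'I_(2 * N.-1) -> {ffun 'I_M -> bool}) (s : nat -> bool -> V) :
  \det (Gmx g beta) != 0 -> forall (j0 : 'I_N.-1) k0,
  s j0 k0 = \sum_r rC (invmx (Gmx g beta) (col_index j0 k0) r) *:
            \sum_(j < N.-1) \sum_k rC (g j k (beta r)) *: s j k.
Proof.
move=> dG j0 k0; set c0 := col_index j0 k0.
have GE r (j : 'I_N.-1) k : Gmx g beta r (col_index j k) = g j k (beta r).
  rewrite mxE /=; case: k; last by rewrite mul0n add0n ltn_ord.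
  by rewrite mul1n ltnNge leq_addr /= addKn.
have inv (j : 'I_N.-1) k : \sum_r invmx (Gmx g beta) c0 r * g j k (beta r)
    = (c0 == col_index j k)%:R.
  have : invmx (Gmx g beta) *m Gmx g beta = 1%:M by apply: mulVmx; rewrite unitmxE unitfE.
  move=> /matrixP /(_ c0 (col_index j k)); rewrite !mxE => <-.
  by apply: eq_bigr => r _; rewrite GE.
transitivity (\sum_(j < N.-1) \sum_k rC (c0 == col_index j k)%:R *: s j k).
  rewrite (bigD1 j0) //= (bigD1 k0) //= eqxx rC1 scale1r.
  rewrite big1 ?addr0 => [|k kk]; last first.
    case: eqP => [/col_index_inj [_ ek]|_]; last by rewrite rC0 scale0r.
    by rewrite ek eqxx in kk.
  rewrite big1 ?addr0 // => j jj; rewrite big1 // => k _.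
  case: eqP => [/col_index_inj [ej _]|_]; last by rewrite rC0 scale0r.
  by rewrite ej eqxx in jj.
under [RHS]eq_bigr => r _ do rewrite scaler_sumr.
rewrite [RHS]exchange_big /=; apply: eq_bigr => j _.
under [RHS]eq_bigr => r _ do rewrite scaler_sumr.
rewrite [RHS]exchange_big /=; apply: eq_bigr => k _ /=.
rewrite -inv rC_sum scaler_suml; apply: eq_bigr => r _.
by rewrite scalerA rCM.
Qed.

Theorem theorem1 (R : realType) (N M : nat) (HN : (2 <= N)%N) (HM : (2 < M)%N)
  (E : 'I_N -> R) (HE : \sum_(j < N) E j = 0)
  (d : nat -> R) (hw : 'I_M -> R) (c : nat -> R)
  (g : nat -> bool -> {ffun 'I_M -> bool} -> R)
  (cond1 : forall j : nat, (j < M.-1)%N -> c j != 0)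
  (cond2 : exists beta : 'I_(2 * N.-1) -> {ffun 'I_M -> bool},
             \det (Gmx g beta) != 0)
  (cond3 : generates_su (fun X : 'M[R[i]]_N =>
             X = 'i *: HS E \/
             X = 'i *: \sum_(j < N.-1) rC (d j) *: @xS R N j)) :
  generates_su (ctrl_gens (H0 E d hw c g)).
Proof.
(* One inclusion holds because [su] is Lie-closed and contains the generators. *)
move=> X; split; first by apply; [apply: su_closed | apply: su_ctrl_gens].
set L := lie_gen _; have LL : lie_closed L := lie_gen_closed _.
have gen1 p j : ctrl_gens (H0 E d hw c g) ('i *: kron 1 (sigma1 R (pl p) j)) ->
    L (kps 'i%:M (single j p)).
  move=> h; have := lie_gen_in h.
  by rewrite -scalemx1 /kps kronZl sigma1_ps.
have Lx j : L (kps 'i%:M (single j lx)) by apply: gen1; right; exists j; left.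
have Ly j : L (kps 'i%:M (single j ly)) by apply: gen1; right; exists j; right.
have LH : L ('i *: H0 E d hw c g) by apply: lie_gen_in; left.
have Lxx (j k : 'I_M) : k = j.+1 :> nat -> L (kps 'i%:M (single j lx + single k lx)).
  move=> jk; have jM : (j < M.-1)%N by have := ltn_ord k; lia.
  (* Projecting the drift leaves [c j] times the wanted coupling; condition 1 permits division by
     [c j]. *)
  have := project_singles_closed LL Lx Ly (lab_xx M j) LH.
  rewrite projectZ project_H0_xx // scalerA mulrC -scalerA -kronZl scalemx1 -(lab_xxE jk).
  by apply: (lie_closed_unscale LL); apply: cond1.
have M1 : (1 < M)%N by lia.
apply: (su_sub_closed LL HN M1 Lx Ly Lxx _ HE cond3) => j b jN.
have [beta dG] := cond2.
(* Condition 2 writes [s_j^(k)] as a real combination of the operators coupled to the strings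
   [beta r], each of which is projected out of [i H_0]. *)
have -> : sS R N j b = _ := Gmx_invert (sS R N) dG (Ordinal jN) b.
rewrite scaler_sumr.
apply: (lie_closed_sum (nonlocal_closed LL Lx Ly Lxx M1)) => r _.
rewrite scalerA mulrC -scalerA; apply: nonlocalZ => //.
have b0 : lab_xy (beta r) != 0.
  by apply: contraNneq (lab_xy_neq0 (beta r) (Ordinal (ltnW M1))) => ->; rewrite ffunE.
apply: (nonlocal1 LL Lx Ly Lxx b0).
rewrite /kps kronZl -/(kps _ _) -(project_H0_xy E d hw c g HM).
by rewrite -projectZ; apply: (project_singles_closed LL Lx Ly).
Qed.
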